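(* Let $G=\mathbb{Z}_{n_1}\oplus\mathbb{Z}_{n_2}\oplus\cdots\oplus\mathbb{Z}_{n_k}$ with $1<n_1\mid n_2\mid\cdots\mid n_k$ be a finite abelian group. Let $M$ be a set of integers and $S\subseteq G$ such that $G=MS$ is a complete splitting, and let $m\in M$, $g\in S$ be such that $0=mg$. Then: (i) $mS=mG$; (ii) $g=\left(0,0,\ldots,0,\,y_k\frac{n_k}{(m,n_k)}\right)$ for some integer $y_k$ with $\gcd(y_k,(m,n_k))=1$; (iii) $Mg=\langle g\rangle$ and $|M|=(m,n_k)$. That is, there are integers $y_{ij}$ (one for each pair consisting of an element $g_j\in\mathbb{Z}_{n_1}\oplus\cdots\oplus\mathbb{Z}_{n_{k-1}}$ and an integer $i\in[0,\frac{n_k}{(m,n_k)}-1]$) such that $$S=\left\{\left(g_j,\ i+y_{ij}\tfrac{n_k}{(m,n_k)}\right): g_j\in\mathbb{Z}_{n_1}\oplus\cdots\oplus\mathbb{Z}_{n_{k-1}},\ i\in\left[0,\tfrac{n_k}{(m,n_k)}-1\right]\right\},$$ and $M$ is a complete set of representatives modulo $\mathrm{ord}(g)$.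
   Context: For a set of integers $M$ and a subset $S$ of a finite abelian group $G$ (written additively), $G=MS$ is a complete splitting if every element of $G$ (including $0$) has a unique representation $ms$ with $m\in M$, $s\in S$. Notation: $mS=\{ms:s\in S\}$, $mG=\{mh:h\in G\}$, $Mg=\{m'g:m'\in M\}$; $\langle g\rangle$ is the cyclic subgroup generated by $g$ and $\mathrm{ord}(g)$ its order; $(a,b)$ denotes the greatest common divisor of the integers $a,b$ (with $(0,b)=b$ for $b>0$); $[a,b]$ denotes the set of integers $t$ with $a\le t\le b$. A complete set of representatives modulo $N$ is a set of integers containing exactly one element from each residue class modulo $N$. *)

(* Defs.v *)
From HB Require Import structures.
From mathcomp Require Import all_boot all_order all_algebra all_fingroup.
From mathcomp Require Import boolp classical_sets functions cardinality.

Set Implicit Arguments.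
Unset Strict Implicit.
Unset Printing Implicit Defensive.

Import Order.TTheory GRing.Theory Num.Theory.
Local Open Scope classical_set_scope.
Local Open Scope ring_scope.

(* The direct sum Z_{n_0} (+) ... (+) Z_{n_(m-1)}, with componentwise addition.
   It is only meaningful when all the n_i are at least 2, because 'Z_0 and 'Z_1
   both denote the integers modulo 2.  The multiplicative notation of fingroup,
   e.g. <[g]> and #[g], refers to the additive group law. *)
Definition zdsum (m : nat) (n : 'I_m -> nat) : Type :=
  {dffun forall i : 'I_m, 'Z_(n i)}.

Section DirectSum.
Variables (m : nat) (n : 'I_m -> nat).

HB.instance Definition _ := Finite.on (zdsum n).

Definition zdsum_zero : zdsum n := [ffun i => 0 : 'Z_(n i)].
Definition zdsum_opp (x : zdsum n) : zdsum n := [ffun i => - x i].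
Definition zdsum_add (x y : zdsum n) : zdsum n := [ffun i => x i + y i].

Fact zdsum_addA : associative zdsum_add.
Proof. by move=> x y z; apply/ffunP=> i; rewrite !ffunE addrA. Qed.
Fact zdsum_addC : commutative zdsum_add.
Proof. by move=> x y; apply/ffunP=> i; rewrite !ffunE addrC. Qed.
Fact zdsum_add0 : left_id zdsum_zero zdsum_add.
Proof. by move=> x; apply/ffunP=> i; rewrite !ffunE add0r. Qed.
Fact zdsum_addN : left_inverse zdsum_zero zdsum_opp zdsum_add.
Proof. by move=> x; apply/ffunP=> i; rewrite !ffunE addNr. Qed.

HB.instance Definition _ := GRing.isZmodule.Build (zdsum n)
  zdsum_addA zdsum_addC zdsum_add0 zdsum_addN.
HB.instance Definition _ := [finGroupMixin of zdsum n for +%R].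

End DirectSum.

(* An element x of Z_{n_0} (+) ... (+) Z_{n_k} is the pair
   (zdsum_init x, x ord_max). *)
Definition zdsum_init (k : nat) (n : 'I_k.+1 -> nat) (x : zdsum n) :
    zdsum (fun j : 'I_k => n (widen_ord (leqnSn k) j)) :=
  [ffun j => x (widen_ord (leqnSn k) j)].

Definition complete_splitting (G : finZmodType) (M : set int) (S : set G) : Prop :=
  forall x : G, exists! ms : int * G, [/\ M ms.1, S ms.2 & x = ms.2 *~ ms.1].

Definition complete_residues (N : nat) (M : set int) : Prop :=
  forall r : int, exists! t : int, M t /\ (t = r %[mod N])%Z.

(* Main.v *)
(* If 0 = m g, then comparing |M| |S| = |G| with |M| <= ord g, |S| <= |mG| and
   <g> <= ker m forces <g> = ker m: multiplication by m is a bijection from S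
   onto mG, so S is a transversal of the cosets of <g>.  Being cyclic, ker m is
   generated by (0, ..., 0, n_k / (m, n_k)): this element has order (m, n_k),
   while (m, n_k) annihilates ker m. *)
Require Import Defs.
From HB Require Import structures.
From mathcomp Require Import all_boot all_order all_algebra all_fingroup.
From mathcomp Require Import boolp classical_sets functions cardinality.
From mathcomp Require Import cyclic ring.

Set Implicit Arguments.
Unset Strict Implicit.
Unset Printing Implicit Defensive.

Import Order.TTheory GRing.Theory Num.Theory FinRing.Theory.
Local Open Scope classical_set_scope.
Local Open Scope card_scope.
Local Open Scope ring_scope.

(** * Integer multiples and orders in a finite abelian group *)

Lemma mulrz_eq0_order (G : finZmodType) (x : G) (a : int) :
  (x *~ a == 0) = (#[x]%g %| `|a|)%N.
Proof.
case: (intP a) => [|b|b]; first by rewrite mulr0z eqxx dvdn0.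
- by rewrite order_dvdn zmodXgE.
- by rewrite mulrNz oppr_eq0 abszN order_dvdn zmodXgE.
Qed.

Lemma eq_mulrz_order (G : finZmodType) (x : G) (a b : int) :
  (x *~ a == x *~ b) = (a == b %[mod #[x]%g])%Z.
Proof. by rewrite -subr_eq0 -mulrzBr mulrz_eq0_order eqz_mod_dvd. Qed.

Lemma mulrz_cycle (G : finZmodType) (x : G) (a : int) : x *~ a \in <[x]>%g.
Proof.
case: (intP a) => [|b|b]; first exact: group1.
- by have := mem_cycle x b.+1; rewrite zmodXgE.
- by have := groupVr (mem_cycle x b.+1); rewrite zmodXgE zmodVgE mulrNz.
Qed.

(** First isomorphism theorem together with Lagrange, for the endomorphism [x *~ a] of an abelian
    group. *)
Lemma card_mulrz_ker (G : finZmodType) (a : int) :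
  (#|[set x : G | x *~ a == 0%R]%SET| * #|[set x *~ a | x in [set: G]]%SET| =
   #|G|)%N.
Proof.
have fM : {in [set: G]%SET &, {morph (fun x : G => x *~ a) : x y / (x * y)%g}}.
  by move=> x y _ _; rewrite !zmodMgE mulrzDl.
have kerE : ('ker (Morphism fM) = [set x : G | x *~ a == 0%R]%SET)%g.
  by apply/finset.setP => x; rewrite !inE.
have := card_morphim (Morphism fM) [set: G]%G.
rewrite finset.setIid morphimEdom /= => imE.
rewrite -cardsT -(Lagrange (finset.subsetT ('ker (Morphism fM))%G)) -imE.
by congr (_ * _)%N; rewrite -kerE.
Qed.

(** * Complete splittings in which zero is represented as [g *~ m] *)

Section Splitting.
Variables (G : finZmodType) (M : set int) (S : set G).
Hypothesis hMS : complete_splitting M S.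

Lemma splitting_inj (a b : int) (s t : G) :
  M a -> S s -> M b -> S t -> s *~ a = t *~ b -> a = b /\ s = t.
Proof.
move=> Ma Ss Mb St e; have [p [_ pu]] := hMS (s *~ a).
have h1 : p = (a, s) by apply: pu.
have h2 : p = (b, t) by apply: pu.
by move: h2; rewrite h1 => -[].
Qed.

Variables (m : int) (g : G).
Hypotheses (hm : M m) (hg : S g) (h0 : 0 = g *~ m).

(* Sending [m' s] to the pair [(m' g, m s)] injects [G] into [<g> x mG], while
   [<g>] lies in the kernel of multiplication by [m]: counting forces equality
   everywhere. *)
Lemma splitting_zero :
  <[g]>%g = [set x : G | x *~ m == 0]%SET /\
  forall (r : int) (h : G),
    exists a s, [/\ M a, S s, g *~ a = g *~ r & s *~ m = h *~ m].
Proof.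
have /choice[f fP] : forall x, exists p : int * G,
    [/\ M p.1, S p.2 & x = p.2 *~ p.1].
  by move=> x; have [p [? _]] := hMS x; exists p.
pose phi x := (g *~ (f x).1, (f x).2 *~ m).
(* Both components are themselves products of an element of [M] and one of [S], because [g] lies in
   [S] and [m] in [M]; uniqueness recovers the two factors of [x]. *)
have phi_inj : injective phi.
  move=> x y [e1 e2]; have [Mx Sx ->] := fP x; have [My Sy ->] := fP y.
  have [-> _] := splitting_inj Mx hg My hg e1.
  by have [_ ->] := splitting_inj hm Sx hm Sy e2.
set K := [set x : G | x *~ m == 0]%SET; pose I := [set x *~ m | x in [set: G]]%SET.
have sub : (phi @: [set: G] \subset finset.setX <[g]>%g I)%SET.
  apply/fintype.subsetP => _ /imsetP[x _ ->].
  by rewrite !inE mulrz_cycle /=; apply/imsetP; exists (f x).2.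
have sgK : (<[g]>%g \subset K)%SET.
  apply/fintype.subsetP => _ /cycleP[i ->].
  by rewrite inE zmodXgE pmulrn mulrzAC -h0 mul0rz.
have cphi : #|(phi @: [set: G])%SET| = #|G| by rewrite card_imset ?cardsT.
have cK : (#|K| * #|I| = #|G|)%N := card_mulrz_ker G m.
have I_gt0 : (0 < #|I|)%N by apply/card_gt0P; exists (0 *~ m); apply/imset_f/finset.in_setT.
have le1 := subset_leq_card sub; rewrite cphi cardsX in le1.
(* Cancelling [#|I|] in |K| |I| = |G| <= |<g>| |I| leaves |K| <= |<g>|. *)
have gK : <[g]>%g = K.
  by apply/eqP; rewrite eqEcard sgK -(leq_pmul2r I_gt0) cK.
split=> // r h.
(* With [<[g]>] equal to the kernel, source and target of [phi] have the same size, so [phi] is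
   onto. *)
have /eqP im : (phi @: [set: G] == finset.setX <[g]>%g I)%SET.
  by rewrite eqEcard sub cardsX gK cK cphi; exact: leqnn.
have : (g *~ r, h *~ m) \in finset.setX <[g]>%g I.
  by rewrite inE mulrz_cycle; apply/imsetP; exists h.
rewrite -im => /imsetP[x _ [-> ->]]; have [? ? _] := fP x.
by exists (f x).1, (f x).2.
Qed.

(** Residues modulo the order of [g] correspond to multiples of [g]. Surjectivity reaches each of
    them from [M], and two elements of [M] reaching the same one would represent it twice. *)
Lemma splitting_complete_residues : complete_residues #[g]%g M.
Proof.
move=> r; have [a [s [Ma _ e _]]] := splitting_zero.2 r 0.
exists a; split; first by split=> //; apply/eqP; rewrite -eq_mulrz_order e.
move=> b [Mb /eqP]; rewrite -eq_mulrz_order -e => /eqP eb.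
by have [] := splitting_inj Ma hg Mb hg (esym eb).
Qed.

End Splitting.

Lemma complete_residues_card (N : nat) (M : set int) :
  (0 < N)%N -> complete_residues N M -> M #= `I_N.
Proof.
move=> N_gt0 hM; have N0 : N%:Z != 0 by rewrite eqz_nat -lt0n.
have modK (t : int) : (`|(t %% N)%Z|%N)%:Z = (t %% N)%Z.
  by rewrite gez0_abs // modz_ge0.
(* Reduction modulo [N] is the bijection; the absolute value only turns the nonnegative remainder
   into a natural number. *)
apply/card_set_bijP; exists (fun t => `|(t %% N)%Z|%N); split.
- by move=> t _ /=; rewrite -ltz_nat modK ltz_pmod.
- move=> t t' /set_mem Mt /set_mem Mt' e; have [u [_ uP]] := hM t'.
  by rewrite -(uP t) ?(uP t') //; split=> //; rewrite -modK e modK.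
- move=> i /= lt_iN; have [t [[Mt e] _]] := hM i; exists t => //.
  by apply/eqP; rewrite -eqz_nat modK e modz_small.
Qed.

(** * The direct sum and its last coordinate *)

Section DirectSumTheory.
Variables (m : nat) (n : 'I_m -> nat).

Lemma zdsumMn (x : zdsum n) (a : nat) i : (x *+ a) i = x i *+ a.
Proof. by elim: a => [|a IH]; rewrite ?mulr0n ?mulrS ffunE ?IH. Qed.

Lemma zdsumMz (x : zdsum n) (a : int) i : (x *~ a) i = x i *~ a.
Proof.
by case: (intP a) => [|b|b]; rewrite ?mulr0z ?mulrNz ?ffunE -?pmulrn ?zdsumMn.
Qed.

End DirectSumTheory.

Lemma Zp_nat_eq0 (p a : nat) : (1 < p)%N -> (a%:R == 0 :> 'Z_p) = (p %| a)%N.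
Proof. by move=> p_gt1; rewrite -val_eqE /= val_Zp_nat. Qed.

Section Last.
Variables (k : nat) (n : 'I_k.+1 -> nat).

Lemma zdsum_lastP (x y : zdsum n) :
  zdsum_init x = zdsum_init y -> x ord_max = y ord_max -> x = y.
Proof.
move=> ei el; apply/ffunP => i.
have [lt_ik|] := ltnP i k.
  have -> : i = widen_ord (leqnSn k) (Ordinal lt_ik) by apply: val_inj.
  by have /ffunP/(_ (Ordinal lt_ik)) := ei; rewrite !ffunE.
move=> le_ki; suff -> : i = ord_max by [].
by apply/val_inj/eqP; rewrite /= eqn_leq le_ki -ltnS ltn_ord.
Qed.

Lemma zdsum_last_ex (x : zdsum (fun j : 'I_k => n (widen_ord (leqnSn k) j)))
    (a : 'Z_(n ord_max)) :
  exists y : zdsum n, zdsum_init y = x /\ y ord_max = a.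
Proof.
(* Passing through natural number representatives avoids type casts. *)
exists [ffun i : 'I_k.+1 =>
  (if (insub (i : nat) : option 'I_k) is Some j then (x j : nat)%:R
   else (a : nat)%:R) : 'Z_(n i)]; split.
  by apply/ffunP => j; rewrite !ffunE /= valK natr_Zp.
by rewrite ffunE insubF ?natr_Zp //= ltnn.
Qed.

Hypothesis hn1 : forall i, (1 < n i)%N.
Hypothesis hdvd : forall i j : 'I_k.+1, j = i.+1 :> nat -> (n i %| n j)%N.

Lemma dvdn_last i : (n i %| n ord_max)%N.
Proof.
(* Divisibility is given only between consecutive moduli, so the induction is on the distance from
   [i] to the last index. *)
have [t et] : exists t, (i + t)%N = k by exists (k - i)%N; rewrite subnKC // -ltnS.
elim: t i et => [|t IH] i et.
  by have -> : i = ord_max by apply: val_inj; rewrite /= -[RHS]et addn0.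
have lt_i : (i.+1 < k.+1)%N by rewrite ltnS -[ltnRHS]et addnS ltnS leq_addr.
by apply: dvdn_trans (IH (Ordinal lt_i) _); rewrite ?hdvd //= addSnnS.
Qed.

(** All moduli divide the last one, which therefore annihilates every coordinate. *)
Lemma order_dvdn_last (x : zdsum n) : (#[x]%g %| n ord_max)%N.
Proof.
rewrite order_dvdn zmodXgE; apply/eqP/ffunP => i; rewrite zdsumMn ffunE.
have n0 : (n ord_max)%:R = 0 :> 'Z_(n i).
  by apply/eqP; rewrite Zp_nat_eq0 ?dvdn_last.
by rewrite -mulr_natr n0 mulr0.
Qed.

Definition zdsum_last (d : nat) : zdsum n :=
  [ffun i => (if i == ord_max then d%:R else 0) : 'Z_(n i)].

Lemma zdsum_last_initMz d a : zdsum_init (zdsum_last d *~ a) = 0.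
Proof.
apply/ffunP => j; rewrite !ffunE zdsumMz ffunE ifN ?mul0rz //.
by rewrite -val_eqE /= neq_ltn ltn_ord.
Qed.

Lemma zdsum_last_maxMz d (a : int) :
  (zdsum_last d *~ a) ord_max = (a * d%:Z)%:~R.
Proof. by rewrite zdsumMz ffunE eqxx pmulrn -mulrzA mulrC. Qed.

Lemma order_zdsum_last e : (e %| n ord_max)%N ->
  #[zdsum_last (n ord_max %/ e)]%g = e.
Proof.
move=> e_dvd; have n_gt0 : (0 < n ord_max)%N := ltnW (hn1 _).
have d_gt0 : (0 < n ord_max %/ e)%N.
  by rewrite divn_gt0 ?(dvdn_leq n_gt0 e_dvd) ?(dvdn_gt0 n_gt0 e_dvd).
(* Two natural numbers with the same multiples are equal. *)
suff dvdE a : (#[zdsum_last (n ord_max %/ e)]%g %| a)%N = (e %| a)%N.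
  by apply/eqP; rewrite eqn_dvd dvdE dvdnn -dvdE dvdnn.
rewrite -[RHS](dvdn_pmul2l d_gt0) divnK // -[RHS]Zp_nat_eq0 //.
rewrite -[LHS](mulrz_eq0_order _ a%:Z).
apply/eqP/eqP => [/ffunP/(_ ord_max)|h].
  by rewrite zdsum_last_maxMz ffunE mulrC -PoszM -pmulrn.
apply: zdsum_lastP; last by rewrite zdsum_last_maxMz mulrC -PoszM -pmulrn h ffunE.
by rewrite zdsum_last_initMz; apply/ffunP => j; rewrite !ffunE.
Qed.

End Last.

Theorem theorem5 (k : nat) (n : 'I_k.+1 -> nat)
    (hn1 : forall i : 'I_k.+1, (1 < n i)%N)
    (hdvd : forall i j : 'I_k.+1, j = i.+1 :> nat -> (n i %| n j)%N)
    (M : set int) (S : set (zdsum n)) (hMS : complete_splitting M S)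
    (m : int) (g : zdsum n) (hm : M m) (hg : S g) (h0 : 0 = g *~ m) :
  let nk := n ord_max in
  let e := gcdn `|m|%N nk in
  let d := (nk %/ e)%N in
  [/\ [set s *~ m | s in S] = [set h *~ m | h in [set: zdsum n]],
      exists yk : int, [/\ zdsum_init g = 0,
        g ord_max = (yk * d%:Z)%:~R & gcdz yk e%:Z = 1],
      [set g *~ m' | m' in M] = [set` <[g]>%g] /\ M #= `I_e,
      exists y : zdsum (fun j : 'I_k => n (widen_ord (leqnSn k) j)) -> 'I_d -> int,
        S = [set x | exists gj, exists i : 'I_d,
               zdsum_init x = gj /\
               x ord_max = ((i : nat)%:Z + y gj i * d%:Z)%:~R] &
      complete_residues #[g]%g M].
Proof.
move=> nk e d.
have nk_gt0 : (0 < nk)%N := ltnW (hn1 _).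
have e_dvd : (e %| nk)%N by apply: dvdn_gcdr.
have e_gt0 : (0 < e)%N by apply: dvdn_gt0 e_dvd.
have d_gt0 : (0 < d)%N by rewrite divn_gt0 // dvdn_leq.
have [gK surj] := splitting_zero hMS hm hg h0.
have memg (x : zdsum n) : (x \in <[g]>%g) = (x *~ m == 0).
  by rewrite [<[g]>%g]gK inE.
pose u := zdsum_last n d.
have ou : #[u]%g = e by apply: order_zdsum_last.
(* The order of [x] always divides [nk], so dividing [m] amounts to dividing the gcd [e]. *)
have kerE (x : zdsum n) : (x *~ m == 0) = (#[x]%g %| e)%N.
  by rewrite mulrz_eq0_order dvdn_gcd order_dvdn_last ?andbT.
have ug : (<[u]> \subset <[g]>)%g by rewrite cycle_subG memg kerE ou.
have og : (#[g]%g %| e)%N by rewrite -kerE -h0.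
(* [<[u]>] has [e] elements and lies in [<[g]>], whose order divides [e]; so [u] generates the
   kernel of [m]. *)
have /eqP gu : (<[u]> == <[g]>)%g.
  by rewrite eqEcard ug -!orderE ou dvdn_leq.
have oge : #[g]%g = e by rewrite orderE -gu -orderE.
have res := splitting_complete_residues hMS hm hg h0.
have kerP (x : zdsum n) : x *~ m = 0 -> exists a : int, x = u *~ a.
  move=> /eqP xm; have : x \in <[u]>%g by rewrite gu memg.
  by case/cycleP => i ->; exists i; rewrite zmodXgE pmulrn.
have ukm a : u *~ a *~ m = 0.
  by have := mulrz_cycle u a; rewrite gu memg => /eqP.
split => //.
- apply/seteqP; split=> _ [h _ <-] /=; first by exists h.
  by have [a [s [_ Ss _ es]]] := surj 0 h; exists s.
- have /cycleP[y gE] : g \in <[u]>%g by rewrite gu cycle_id.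
  exists y; rewrite zmodXgE pmulrn in gE; split.
  + by rewrite gE zdsum_last_initMz.
  + by rewrite gE zdsum_last_maxMz.
  (* A multiple of [u] generates [<[u]>] exactly when its coefficient is coprime to the order
     [e]. *)
  have := generator_coprime u y; rewrite zmodXgE pmulrn -gE /generator gu eqxx ou.
  by move=> /esym/eqP; rewrite /gcdz /= gcdnC => ->.
- split; last by rewrite -oge; apply: complete_residues_card.
  apply/seteqP; split=> [_ [a _ <-]|x /= /cycleP[i ->]] /=.
    exact: mulrz_cycle.
  have [a [_ [Ma _ ea _]]] := surj i 0.
  by exists a => //; rewrite ea zmodXgE pmulrn.
(* Lift the pair to some [x] and take [s] in [S] with the same multiple by [m]. Then [s - x] is in
   the kernel, hence a multiple of [u]; its coefficient is the required [y], and the first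
   coordinates do not change. *)
- have yP (p : zdsum (fun j : 'I_k => n (widen_ord (leqnSn k) j)) * 'I_d) :
      exists y : int, exists2 s, S s &
        zdsum_init s = p.1 /\ s ord_max = ((p.2 : nat)%:Z + y * d%:Z)%:~R.
    have [x [xi xl]] := zdsum_last_ex p.1 (p.2 : nat)%:R.
    have [_ [s [_ Ss _ es]]] := surj 0 x.
    have /kerP[y sE] : (s - x) *~ m = 0 by rewrite mulrzBl es subrr.
    exists y, s => //; rewrite -(subrK x s) sE; split.
      rewrite -xi; apply/ffunP => j; rewrite !ffunE.
      by have /ffunP/(_ j) := zdsum_last_initMz n d y; rewrite !ffunE => ->;
        rewrite add0r.
    by rewrite ffunE zdsum_last_maxMz xl rmorphD /= addrC.
  have [y hy] := choice yP; exists (fun gj i => y (gj, i)).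
  apply/seteqP; split=> x /=; last first.
    case=> gj [i [xi xl]]; have [s Ss [si sl]] := hy (gj, i).
    by have -> : x = s by apply: zdsum_lastP; rewrite ?xi ?si ?xl ?sl.
  (* The index has to be the last coordinate of [x] reduced modulo [d]. *)
  move=> Sx; pose t : nat := x ord_max.
  have lt_td : (t %% d < d)%N by rewrite ltn_mod.
  exists (zdsum_init x), (Ordinal lt_td).
  have [s Ss [si sl]] := hy (zdsum_init x, Ordinal lt_td).
  suff xs : x = s by split=> //; rewrite -xs in sl.
  (* Multiplication by [m] kills [u] and is injective on [S], so two elements of [S] differing by a
     multiple of [u] coincide. *)
  suff [a sE] : exists a : int, s = x + u *~ a.
    have es : s *~ m = x *~ m by rewrite sE mulrzDl ukm addr0.
    by have [_ ->] := splitting_inj hMS hm Ss hm Sx es.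
  (* The last coordinates are [t %% d + y * d] for [s] and [(t %/ d) * d + t %% d] for [x]; this is
     their difference divided by [d]. *)
  exists (y (zdsum_init x, Ordinal lt_td) - (t %/ d)%N%:Z).
  apply: zdsum_lastP.
    rewrite si; apply/ffunP => j; rewrite !ffunE.
    have /ffunP/(_ j) := zdsum_last_initMz n d
      (y (zdsum_init x, Ordinal lt_td) - (t %/ d)%N%:Z).
    by rewrite !ffunE => ->; rewrite addr0.
  rewrite sl ffunE zdsum_last_maxMz /= -[x ord_max]natr_Zp -/t pmulrn -rmorphD /=.
  have tE : t%:Z = (t %/ d)%N%:Z * d%:Z + (t %% d)%N%:Z.
    by rewrite [in LHS](divn_eq t d).
  by congr (_%:~R); rewrite [X in _ = X + _]tE; ring.
Qed.
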